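(* Let $K$ be a field, $n$ a positive integer, and let $\Lambda\subseteq\Theta_n$ be an index set. If $\Lambda$ has a quadruple of multiplicity one, then no elements of $\mathcal S_\Lambda(K)$ satisfy the Jacobi Identity.
   Context: Notation. $[n]=\{1,\dots,n\}$; $\Upsilon_n=\{(i,j,k)\in[n]^3 : i<j\}$; $\Theta_n=\{(i,j,k)\in[n]^3 : i<j<k\}$. An index set is a subset of $\Upsilon_n$. Fix a basis $x_1,\dots,x_n$ of $K^n$. An element $\alpha\in\wedge^2(K^n)^*\otimes K^n$ is an alternating bilinear map $K^n\times K^n\to K^n$ with structure constants given by $\alpha(x_i,x_j)=\sum_k\alpha_{ij}^k x_k$. $\mathcal S_\Lambda(K)$ is the set of all such $\alpha$ for which, for all $(i,j,k)\in\Upsilon_n$, $\alpha_{ij}^k\ne0$ if and only if $(i,j,k)\in\Lambda$. To a triple $(i,j,k)$ associate the real root vector $\mathbf y_{(i,j,k)}=\mathbf e_i+\mathbf e_j-\mathbf e_k\in\mathbb R^n$. Two triples $\mathbf t_1=(i_1,j_1,k_1),\mathbf t_2=(i_2,j_2,k_2)\in\Theta_n$ form an (unordered) aligned pair if $\langle\mathbf y_{\mathbf t_1},\mathbf y_{\mathbf t_2}\rangle=-1$ (standard inner product). In this case the symmetric difference of $\{i_1,j_1,k_1\}$ and $\{i_2,j_2,k_2\}$ has four elements $q_1<q_2<q_3<q_4$, and $q(\mathbf t_1,\mathbf t_2)=(q_1,q_2,q_3,q_4)$ is the quadruple of the pair. The quadruples for $\Lambda$ are those arising from aligned pairs of triples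 in $\Lambda$; a quadruple has multiplicity $m$ if it arises from exactly $m$ distinct (unordered) aligned pairs of triples in $\Lambda$. The Jacobi Identity for $\alpha$ is $\alpha(\alpha(x,y),z)+\alpha(\alpha(y,z),x)+\alpha(\alpha(z,x),y)=0$ for all $x,y,z\in K^n$. *)

(* Defs.v *)
(* Mathematical Components; only realType comes from MathComp-Analysis. *)
From mathcomp Require Import all_boot all_order all_algebra.
From mathcomp Require Import sesquilinear.
From mathcomp Require Import reals.

Set Implicit Arguments.
Unset Strict Implicit.
Unset Printing Implicit Defensive.

Import Order.TTheory GRing.Theory Num.Theory.
Local Open Scope ring_scope.

(* [n] = {1, ..., n} is modelled by 'I_n = {0, ..., n-1}; only the order of
   the indices matters. The triple (i, j, k) is ((i, j), k). *)
Notation triple n := ('I_n * 'I_n * 'I_n)%type.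

Definition Upsilon (n : nat) : {set triple n} :=
  [set t : triple n | (t.1.1 < t.1.2)%N].

Definition Theta (n : nat) : {set triple n} :=
  [set t : triple n | (t.1.1 < t.1.2)%N && (t.1.2 < t.2)%N].

Definition inner_product (R : realType) (n : nat) (u v : 'rV[R]_n) : R :=
  \sum_(i < n) u 0 i * v 0 i.

Definition root_vector (R : realType) (n : nat) (t : triple n) : 'rV[R]_n :=
  delta_mx 0 t.1.1 + delta_mx 0 t.1.2 - delta_mx 0 t.2.

Definition aligned (R : realType) (n : nat) (t1 t2 : triple n) : bool :=
  [&& t1 \in Theta n, t2 \in Theta n &
      inner_product (root_vector R t1) (root_vector R t2) == -1].

Definition entries (n : nat) (t : triple n) : {set 'I_n} :=
  [set t.1.1; t.1.2; t.2].

(* q = (q_1, q_2, q_3, q_4) with q_1 < q_2 < q_3 < q_4 the elements of the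
   symmetric difference of the two sets of entries. *)
Definition is_quadruple_of (n : nat) (q : 4.-tuple 'I_n) (t1 t2 : triple n) :
    bool :=
  sorted (fun i j : 'I_n => (i < j)%N) q &&
  ([set x in q] ==
     (entries t1 :\: entries t2) :|: (entries t2 :\: entries t1)).

(* An unordered pair is the set [set t1; t2]; the members of an aligned pair
   are distinct because <y_t, y_t> = 3 for t in Theta n. *)
Definition aligned_pairs (R : realType) (n : nat) (Lambda : {set triple n})
    (q : 4.-tuple 'I_n) : {set {set triple n}} :=
  [set p : {set triple n} |
    [exists t1 in Lambda, exists t2 in Lambda,
      [&& p == [set t1; t2], aligned R t1 t2 & is_quadruple_of q t1 t2]]].

Definition quadruples (R : realType) (n : nat) (Lambda : {set triple n}) :
    {set 4.-tuple 'I_n} :=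
  [set q : 4.-tuple 'I_n |
    [exists t1 in Lambda, exists t2 in Lambda,
      aligned R t1 t2 && is_quadruple_of q t1 t2]].

Definition multiplicity (R : realType) (n : nat) (Lambda : {set triple n})
    (q : 4.-tuple 'I_n) : nat :=
  #|aligned_pairs R Lambda q|.

(* x is the chosen basis of K^n; structure_constant x alpha i j k is
   alpha_{ij}^k. *)
Definition structure_constant (K : fieldType) (n : nat)
    (x : n.-tuple 'rV[K]_n)
    (alpha : {bilinear 'rV[K]_n -> 'rV[K]_n -> 'rV[K]_n}) (i j k : 'I_n) : K :=
  coord x k (alpha (tnth x i) (tnth x j)).

Definition alternating (K : fieldType) (n : nat)
    (alpha : {bilinear 'rV[K]_n -> 'rV[K]_n -> 'rV[K]_n}) : Prop :=
  forall u : 'rV[K]_n, alpha u u = 0.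

Definition in_S (K : fieldType) (n : nat) (x : n.-tuple 'rV[K]_n)
    (Lambda : {set triple n})
    (alpha : {bilinear 'rV[K]_n -> 'rV[K]_n -> 'rV[K]_n}) : Prop :=
  alternating alpha /\
  forall t : triple n, t \in Upsilon n ->
    (structure_constant x alpha t.1.1 t.1.2 t.2 != 0 <-> t \in Lambda).

Definition Jacobi_identity (K : fieldType) (n : nat)
    (alpha : {bilinear 'rV[K]_n -> 'rV[K]_n -> 'rV[K]_n}) : Prop :=
  forall u v w : 'rV[K]_n,
    alpha (alpha u v) w + alpha (alpha v w) u + alpha (alpha w u) v = 0.

(* Main.v *)
Require Import Defs.
From mathcomp Require Import all_boot all_order all_algebra zify ring.
From mathcomp Require Import sesquilinear.
From mathcomp Require Import reals.
Import Order.TTheory GRing.Theory Num.Theory.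

Local Open Scope ring_scope.

(** Let q = (a, b, c, d) be the quadruple of multiplicity one, and evaluate the
    Jacobi identity at x_a, x_b, x_c. Its coordinate along x_d is
    [sum_(i,j,l) sum_m alpha_ij^m * alpha_ml^d], where (i, j, l) runs over the
    three cyclic rotations of (a, b, c) ([coord_nested_bracket]).

    By antisymmetry, alpha_ij^m is nonzero exactly when {i, j} and m form a
    triple of Lambda, written [ordered_triple i j m]
    ([structure_constant_neq0]). So a nonzero summand provides two triples of
    Lambda, ({i, j}, m) and ({m, l}, d). They have inner product -1, because
    the target m of the first is a source of the second and nothing else is
    shared, and their quadruple is q ([rotation_aligned_pair]). Distinct
    summands provide distinct pairs ([rotations_inj]), and every aligned pair
    with quadruple q has this shape ([aligned_inv], [rotations_cover]).

    Hence the nonzero summands correspond one-to-one to the aligned pairs with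
    quadruple q. When there is only one such pair, the coordinate along x_d is
    a single nonzero product, so the Jacobi identity fails. *)

(** * Triples with unordered sources *)

(** The Jacobi sum contains alpha_ij^k for i and j in either order, whereas
    Lambda only lists triples with i < j; up to sign, alpha_ij^k is the
    structure constant at this triple. For i = j the value is not in
    [Theta n], in accordance with alpha_ii^k = 0. *)
Definition ordered_triple (n : nat) (i j k : 'I_n) : triple n :=
  if (i < j)%N then (i, j, k) else (j, i, k).

Lemma ordered_triple_id (n : nat) (i j k : 'I_n) :
  (i < j)%N -> ordered_triple n i j k = (i, j, k).
Proof. by rewrite /ordered_triple => ->. Qed.

Lemma ordered_tripleC (n : nat) (i j k : 'I_n) :
  i != j -> ordered_triple n i j k = ordered_triple n j i k.
Proof. by rewrite /ordered_triple -val_eqE /=; case: ltngtP. Qed.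

Lemma ordered_triple_snd (n : nat) (i j k : 'I_n) :
  (ordered_triple n i j k).2 = k.
Proof. by rewrite /ordered_triple; case: ifP. Qed.

Lemma ordered_triple_Theta (n : nat) (i j k : 'I_n) :
  (ordered_triple n i j k \in Theta n) = [&& i != j, (i < k)%N & (j < k)%N].
Proof. by rewrite /ordered_triple inE -val_eqE; case: ifP => /=; lia. Qed.

Lemma entries_ordered_triple (n : nat) (i j k : 'I_n) :
  entries (ordered_triple n i j k) = [set i; j; k].
Proof.
by rewrite /ordered_triple /entries; case: ifP => //= _; rewrite (setUC [set j]).
Qed.

(** * Aligned pairs *)

(** Splitting the inner product into a difference of two natural numbers turns
    alignment into arithmetic on coincidences between indices. *)
Lemma inner_product_root_vector (R : realType) (n : nat) (s t : triple n) :
  inner_product (root_vector R s) (root_vector R t) =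
  ((s.1.1 == t.1.1) + (s.1.1 == t.1.2) + (s.1.2 == t.1.1) + (s.1.2 == t.1.2)
    + (s.2 == t.2))%:R
  - ((s.1.1 == t.2) + (s.1.2 == t.2) + (s.2 == t.1.1) + (s.2 == t.1.2))%:R.
Proof.
have ee (i j : 'I_n) :
    \sum_l (delta_mx 0 i : 'rV[R]_n) 0 l * (delta_mx 0 j : 'rV[R]_n) 0 l
    = (i == j)%:R.
  rewrite (bigD1 i) //= big1 => [|l /negPf li]; last first.
    by rewrite mxE li mul0r.
  by rewrite !mxE !eqxx mul1r addr0.
have rv (u : triple n) l : root_vector R u 0 l =
    (delta_mx 0 u.1.1 : 'rV_n) 0 l + (delta_mx 0 u.1.2 : 'rV_n) 0 l
    - (delta_mx 0 u.2 : 'rV_n) 0 l by rewrite !mxE.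
rewrite /inner_product.
under eq_bigr => l _ do rewrite !rv mulrBl !mulrDl !mulrBr !mulrDr.
rewrite !(sumrB, big_split) /= !ee !natrD; ring.
Qed.

(** The coincidence of the target m of the first triple with a source of the
    second contributes -1. Every other coincidence is excluded, either by the
    order (i, j < m < k and l < k) or by l being distinct from i and j. *)
Lemma aligned_ordered_triples (R : realType) (n : nat) (i j m l k : 'I_n) :
  ordered_triple n i j m \in Theta n -> ordered_triple n m l k \in Theta n ->
  l != i -> l != j ->
  aligned R (ordered_triple n i j m) (ordered_triple n m l k).
Proof.
move=> t1 t2 li lj; rewrite /aligned t1 t2 /= inner_product_root_vector.
set A := (X in X%:R - _); set B := (X in _ - X%:R).
suff: (A = 0 /\ B = 1)%N by case=> -> ->; rewrite sub0r.
move: t1 t2 li lj; rewrite {}/A {}/B !ordered_triple_Theta /ordered_triple.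
by do 2 case: ifP => /=; rewrite -!val_eqE /=; lia.
Qed.

(** Converse of [aligned_ordered_triples]. A coincidence counted with sign -1
    must occur, so one target is a source of the other triple. Then the order
    forbids any second negative coincidence, hence also any positive one, which
    is why the remaining source l is new. *)
Lemma aligned_inv (R : realType) (n : nat) (i1 j1 k1 i2 j2 k2 : 'I_n) :
  aligned R (i1, j1, k1) (i2, j2, k2) ->
  (exists l, [/\ (i2, j2, k2) = ordered_triple n k1 l k2, l != i1 & l != j1])
  \/
  (exists l, [/\ (i1, j1, k1) = ordered_triple n k2 l k1, l != i2 & l != j2]).
Proof.
rewrite /aligned inner_product_root_vector.
set A := (X in X%:R - _); set B := (X in _ - X%:R) => /and3P[t1 t2 /eqP e].
have {e} : A.+1 == B.
  by rewrite -(eqr_nat R) -natr1 -subr_eq0 addrAC e addNr.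
rewrite {}/A {}/B; move: t1 t2; rewrite !inE /= => t1 t2 e.
have [kij|kij] := boolP ((k1 == i2) || (k1 == j2)); [left | right].
  move: e; case/orP: kij => /eqP ?; subst k1.
    exists j2; rewrite ordered_triple_id; last by lia.
    by split=> //; move: t1 t2 e; rewrite -!val_eqE /=; lia.
  exists i2; rewrite ordered_tripleC ?ordered_triple_id;
    by [split=> //; move: t1 t2 e; rewrite -!val_eqE /=; lia
       | rewrite -?val_eqE /=; lia].
have /orP : (k2 == i1) || (k2 == j1).
  by move: t1 t2 e kij; rewrite -!val_eqE /=; lia.
move: e => /[swap]; case=> /eqP ? e; subst k2.
  exists j1; rewrite ordered_triple_id; last by lia.
  by split=> //; move: t1 t2 e; rewrite -!val_eqE /=; lia.
exists i1; rewrite ordered_tripleC ?ordered_triple_id;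
  by [split=> //; move: t1 t2 e; rewrite -!val_eqE /=; lia
     | rewrite -?val_eqE /=; lia].
Qed.

(** Only the middle index m is common to the two triples of an aligned pair. *)
Lemma symmetric_difference (n : nat) (i j m l k : 'I_n) :
  ordered_triple n i j m \in Theta n -> ordered_triple n m l k \in Theta n ->
  l != i -> l != j ->
  let t1 := ordered_triple n i j m in let t2 := ordered_triple n m l k in
  (entries t1 :\: entries t2) :|: (entries t2 :\: entries t1)
  = [set i; j; l; k].
Proof.
move=> t1 t2 li lj /=; rewrite !entries_ordered_triple.
apply/setP => z; move: t1 t2 li lj.
by rewrite !ordered_triple_Theta !inE -!val_eqE /=; lia.
Qed.

(** * Rotations of three indices *)

(** The index triples (i, j, l) of the nested brackets alpha(alpha(x_i, x_j), x_l)
    in the Jacobi identity at x_a, x_b, x_c; the type of triples only serves to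
    hold three indices here. *)
Definition rotations (n : nat) (a b c : 'I_n) : seq (triple n) :=
  [:: (a, b, c); (b, c, a); (c, a, b)].

(** The two members of the pair are told apart by their targets, as m < k.
    Comparing the members with the smaller target gives m, and then the two
    sources {i, j}, which determine the rotation because a, b, c are
    distinct. *)
Lemma rotations_inj (n : nat) (a b c : 'I_n) (s s' : triple n) (m m' k : 'I_n) :
  (a < b)%N -> (b < c)%N -> (m < k)%N -> (m' < k)%N ->
  s \in rotations n a b c -> s' \in rotations n a b c ->
  [set ordered_triple n s.1.1 s.1.2 m; ordered_triple n m s.2 k] =
  [set ordered_triple n s'.1.1 s'.1.2 m'; ordered_triple n m' s'.2 k] ->
  s = s' /\ m = m'.
Proof.
move=> ab bc mk m'k ss ss' /setP/(_ (ordered_triple n s.1.1 s.1.2 m)).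
rewrite !inE eqxx /= => /esym/orP[]/eqP E; last first.
  have := congr1 snd E; rewrite /= !ordered_triple_snd => mk'.
  by rewrite mk' ltnn in mk.
have := congr1 snd E; rewrite /= !ordered_triple_snd => mm'; split=> //.
have ac := ltn_trans ab bc.
(* (c, a) is the only rotated pair of sources that needs reordering. *)
have ca : ordered_triple n c a m' = (a, c, m').
  by rewrite /ordered_triple ltnNge (ltnW ac).
move: ss ss' E; rewrite mm' !inE.
by do 2 (case/or3P=> /eqP ->) => //=; rewrite ?ca !ordered_triple_id //;
  case=> *; subst; lia.
Qed.

(** The largest element of {a, b, c, d} is d, and that of {i, j, l, k} is k.
    So {i, j, l} = {a, b, c}, and the choice of l in {a, b, c} fixes the
    rotation, up to exchanging i and j. *)
Lemma rotations_cover (n : nat) (a b c d i j l k : 'I_n) :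
  (a < b)%N -> (b < c)%N -> (c < d)%N ->
  i != j -> l != i -> l != j -> (i < k)%N -> (j < k)%N -> (l < k)%N ->
  [set a; b; c; d] = [set i; j; l; k] ->
  k = d /\ exists2 s, s \in rotations n a b c &
    s.2 = l /\ forall m, ordered_triple n s.1.1 s.1.2 m = ordered_triple n i j m.
Proof.
move=> ab bc cd ij li lj ik jk lk /setP E.
have kd : k = d.
  apply/val_inj; move: (E k) (E d); rewrite !inE !eqxx -!val_eqE /=; lia.
subst k; split=> //.
have small z : z != d -> z \in [set i; j; l; d] -> [|| z == a, z == b | z == c].
  by rewrite -E !inE -!orbA => /negPf ->; rewrite orbF.
have rot s : s \in rotations n a b c -> s.2 = l ->
    (s.1.1, s.1.2) = (i, j) \/ (s.1.1, s.1.2) = (j, i) ->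
    exists2 s, s \in rotations n a b c & s.2 = l /\
      forall m, ordered_triple n s.1.1 s.1.2 m = ordered_triple n i j m.
  move=> sr sl sij; exists s; rewrite ?sl //; split=> // m.
  by case: sij => -[-> ->] //; rewrite ordered_tripleC // eq_sym.
have [jS iS lS] : [/\ [|| j == a, j == b | j == c], [|| i == a, i == b | i == c]
    & [|| l == a, l == b | l == c]].
  by split; apply: small; rewrite ?inE ?eqxx ?orbT // -val_eqE /= ltn_eqF.
move: jS iS lS ij li lj rot.
have [r1 r2 r3] : [/\ (a, b, c) \in rotations n a b c,
    (b, c, a) \in rotations n a b c & (c, a, b) \in rotations n a b c].
  by rewrite !inE !eqxx ?orbT.
do 3 (case/or3P=> /eqP ->); rewrite ?eqxx // => _ _ _ rot;
  solve [apply: rot r1 _ _; auto | apply: rot r2 _ _; auto | apply: rot r3 _ _; auto].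
Qed.

(** * Aligned pairs and the terms of the Jacobi sum *)

Lemma quadruple_entries (n : nat) (q : 4.-tuple 'I_n) (t1 t2 : triple n) :
  is_quadruple_of q t1 t2 ->
  exists a b c d : 'I_n, [/\ (a < b)%N, (b < c)%N, (c < d)%N,
    val q = [:: a; b; c; d] & [set x in q] = [set a; b; c; d]].
Proof.
case: q => [[|a [|b [|c [|d [|? ?]]]]] //= qP] /andP[/= /and4P[ab bc cd _] _].
by exists a, b, c, d; split=> //; apply/setP => z; rewrite !inE -!orbA.
Qed.

(** From nonzero terms to aligned pairs. *)
Lemma rotation_aligned_pair (R : realType) (n : nat) (Lambda : {set triple n})
    (q : 4.-tuple 'I_n) (a b c d : 'I_n) (s : triple n) (m : 'I_n) :
  Lambda \subset Theta n -> (a < b)%N -> (b < c)%N -> (c < d)%N ->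
  val q = [:: a; b; c; d] -> s \in rotations n a b c ->
  ordered_triple n s.1.1 s.1.2 m \in Lambda ->
  ordered_triple n m s.2 d \in Lambda ->
  [set ordered_triple n s.1.1 s.1.2 m; ordered_triple n m s.2 d]
    \in aligned_pairs R Lambda q.
Proof.
move=> /subsetP LT ab bc cd qE ss t1 t2.
have [l1 l2] : s.2 != s.1.1 /\ s.2 != s.1.2.
  by move: ss; rewrite !inE => /or3P[] /eqP -> /=; rewrite -!val_eqE /=; lia.
rewrite inE; apply/existsP; exists (ordered_triple n s.1.1 s.1.2 m).
rewrite t1; apply/existsP; exists (ordered_triple n m s.2 d).
rewrite t2 eqxx /= aligned_ordered_triples ?LT //=.
rewrite /is_quadruple_of symmetric_difference ?LT // qE /= ab bc cd /=.
apply/eqP/setP => z; rewrite in_set memtE qE !inE.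
move: ss; rewrite !inE.
by case/or3P=> /eqP -> /=; case: (z == a); case: (z == b); case: (z == c).
Qed.

(** From aligned pairs to nonzero terms: the Jacobi sum attached to a quadruple
    of Lambda has at least one of them. *)
Lemma quadruple_rotation (R : realType) (n : nat) (Lambda : {set triple n})
    (q : 4.-tuple 'I_n) :
  q \in quadruples R Lambda ->
  exists a b c d : 'I_n, [/\ (a < b)%N, (b < c)%N, (c < d)%N,
    val q = [:: a; b; c; d] &
    exists2 s, s \in rotations n a b c &
    exists m, ordered_triple n s.1.1 s.1.2 m \in Lambda /\
              ordered_triple n m s.2 d \in Lambda].
Proof.
rewrite inE => /exists_inP[t1 t1L /exists_inP[t2 t2L /andP[al qq]]].
have [a [b [c [d [ab bc cd qE qS]]]]] := quadruple_entries _ _ _ _ qq.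
exists a, b, c, d; split=> //.
(* [aligned_inv] leaves open which triple feeds into the other, so the
   argument is stated for a pair in a fixed order and used twice. *)
have main (i j m l k : 'I_n) : (i, j, m) \in Theta n ->
    ordered_triple n m l k \in Theta n ->
    (i, j, m) \in Lambda -> ordered_triple n m l k \in Lambda ->
    l != i -> l != j ->
    [set x in q] = entries (i, j, m) :\: entries (ordered_triple n m l k)
      :|: entries (ordered_triple n m l k) :\: entries (i, j, m) ->
    exists2 s, s \in rotations n a b c &
    exists m, ordered_triple n s.1.1 s.1.2 m \in Lambda /\
              ordered_triple n m s.2 d \in Lambda.
  move=> t1T; have ij : (i < j)%N by move: t1T; rewrite inE => /andP[].
  move: t1T; rewrite -(ordered_triple_id _ i j m ij) => t1T t2T t1L' t2L' li lj.
  rewrite symmetric_difference // qS => E.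
  move: (t1T) (t2T); rewrite !ordered_triple_Theta.
  case/and3P=> nij im jm /and3P[ml mk lk].
  have [kd [s sr [sl sm]]] := rotations_cover _ a b c d i j l k ab bc cd nij li lj
    (ltn_trans im mk) (ltn_trans jm mk) lk E.
  by exists s => //; exists m; rewrite sm sl -kd.
move: t1 t2 t1L t2L al qq => [[i1 j1] k1] [[i2 j2] k2] t1L t2L al.
case/andP=> _ /eqP E; move: (al) => /and3P[t1T t2T _].
have [[l [e li lj]]|[l [e li lj]]] := aligned_inv _ _ _ _ _ _ _ _ al.
  by apply: (main i1 j1 k1 l k2); rewrite -?e.
by apply: (main i2 j2 k2 l k1); rewrite -?e // setUC.
Qed.

(** * Structure constants *)

(** The definition of S_Lambda only constrains alpha_ij^k for i < j;
    antisymmetry extends the constraint to all i and j. *)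
Lemma structure_constant_neq0 (K : fieldType) (n : nat)
    (x : n.-tuple 'rV[K]_n) (Lambda : {set triple n})
    (alpha : {bilinear 'rV[K]_n -> 'rV[K]_n -> 'rV[K]_n}) (i j k : 'I_n) :
  Lambda \subset Theta n -> in_S x Lambda alpha ->
  (structure_constant x alpha i j k != 0) = (ordered_triple n i j k \in Lambda).
Proof.
move=> /subsetP LT [alt aS].
have lt (i' j' : 'I_n) : (i' < j')%N ->
    (structure_constant x alpha i' j' k != 0) = ((i', j', k) \in Lambda).
  move=> ij; have U : (i', j', k) \in Upsilon n by rewrite inE.
  by apply/idP/idP => /(aS _ U).
have anti u v : alpha u v = - alpha v u.
  apply/eqP; rewrite -addr_eq0; have /eqP := alt (u + v).
  by rewrite linearDl !linearDr !alt add0r addr0.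
case: (ltngtP i j) => [ij|ji|/val_inj ->].
- by rewrite lt // ordered_triple_id.
- rewrite ordered_tripleC ?ordered_triple_id -?lt //; last first.
    by rewrite -val_eqE gtn_eqF.
  by rewrite /structure_constant anti linearN oppr_eq0.
- rewrite /structure_constant alt linear0 eqxx; apply/esym/negP => /LT.
  by rewrite ordered_triple_Theta eqxx.
Qed.

(** Expanding the inner bracket in the basis turns each summand of the Jacobi
    identity into a quadratic expression in the structure constants. *)
Lemma coord_nested_bracket (K : fieldType) (n : nat) (x : n.-tuple 'rV[K]_n)
    (alpha : {bilinear 'rV[K]_n -> 'rV[K]_n -> 'rV[K]_n}) (i j l k : 'I_n) :
  basis_of fullv x ->
  coord x k (alpha (alpha (tnth x i) (tnth x j)) (tnth x l)) =
  \sum_m structure_constant x alpha i j m * structure_constant x alpha m l k.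
Proof.
move=> hx.
rewrite {1}(coord_basis hx (memvf (alpha (tnth x i) (tnth x j)))).
rewrite linear_sumlz linear_sum; apply: eq_bigr => m _.
by rewrite linearZl_LR linearZ /structure_constant (tnth_nth 0 x m).
Qed.

Theorem corollary2p2 (R : realType) (K : fieldType) (n : nat) (hn : (0 < n)%N)
    (x : n.-tuple 'rV[K]_n) (hx : basis_of fullv x)
    (Lambda : {set triple n}) (hLambda : Lambda \subset Theta n)
    (hq : exists2 q : 4.-tuple 'I_n,
            q \in quadruples R Lambda & multiplicity R Lambda q = 1%N) :
  forall alpha : {bilinear 'rV[K]_n -> 'rV[K]_n -> 'rV[K]_n},
    in_S x Lambda alpha -> ~ Jacobi_identity alpha.
Proof.
move=> alpha aS jac; case: hq => q /quadruple_rotation[a [b [c [d]]]].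
case=> ab bc cd qE [s0 s0r [m0 [t1L t2L]]] /eqP/cards1P[p pE].
have uniq_pair s m : s \in rotations n a b c ->
    ordered_triple n s.1.1 s.1.2 m \in Lambda ->
    ordered_triple n m s.2 d \in Lambda ->
    [set ordered_triple n s.1.1 s.1.2 m; ordered_triple n m s.2 d] = p.
  move=> sr t1 t2; apply/set1P; rewrite -pE.
  apply: (rotation_aligned_pair _ _ _ _ a b c) => //.
pose sc i j k := structure_constant x alpha i j k.
have scE i j k : (sc i j k != 0) = (ordered_triple n i j k \in Lambda).
  exact: structure_constant_neq0.
pose term (u : triple n * 'I_n) := sc u.1.1.1 u.1.1.2 u.2 * sc u.2 u.1.2 d.
have termE u : (term u != 0) = (ordered_triple n u.1.1.1 u.1.1.2 u.2 \in Lambda)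
    && (ordered_triple n u.2 u.1.2 d \in Lambda).
  by rewrite /term mulf_eq0 negb_or !scE.
have sum0 : \sum_(u | u.1 \in rotations n a b c) term u = 0.
  transitivity (\sum_(s in rotations n a b c) \sum_m term (s, m)).
    by rewrite pair_big_dep; apply: eq_big => [[s m]|[s m] _] //=; rewrite andbT.
  rewrite -big_uniq /=; last first.
    by rewrite !inE !xpair_eqE -!val_eqE /=; lia.
  rewrite !big_cons big_nil addr0 addrA /term /= -!coord_nested_bracket //.
  by rewrite -!linearD jac linear0.
(* The term at (s0, m0) is nonzero, yet it is the whole sum: another nonzero
   term would provide the same aligned pair p. *)
have /eqP[] : term (s0, m0) != 0 by rewrite termE t1L t2L.
rewrite -sum0 (bigD1 (s0, m0)) //= big1 ?addr0 // => -[s m] /andP[sr sm].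
apply/eqP; apply: contraR sm => /[!termE] /andP[/= t1 t2].
have lt_d s' m' : ordered_triple n m' s' d \in Lambda -> (m' < d)%N.
  by move/(subsetP hLambda); rewrite ordered_triple_Theta => /and3P[].
have [|-> -> //] := rotations_inj _ a b c s s0 m m0 d ab bc (lt_d _ _ t2)
  (lt_d _ _ t2L) sr s0r.
by rewrite !uniq_pair.
Qed.
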